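(* Let $n\ge1$ be the maximum number of users, let $\mathcal{L}=\mathrm{span}(b_1,\dots,b_m)$ be the family of resource cost functions generated by basis functions $b_1,\dots,b_m$ (all linear combinations with nonnegative coefficients), and let $\bar\Pi\ge{\rm MinPoA}(n,\mathcal{L})$. Let $\{F^{\rm opt}_1,\dots,F^{\rm opt}_m\},\nu^{\rm opt},\rho^{\rm opt},\gamma^{\rm opt},\kappa^{\rm opt}$ be the values determined by a solution of the following program with decision variables $F_j:\{1,\dots,n\}\to\mathbb{R}$ ($j=1,\dots,m$), $\nu^{-1}\rho$, $\gamma$, $\nu^{-1}$, $\kappa\in\mathbb{R}$ (where $\nu^{-1}\rho$ is treated as a single variable, so that $\rho^{\rm opt}$ is the optimal value of $\nu^{-1}\rho$ divided by that of $\nu^{-1}$): $$\begin{aligned}\text{maximize}\quad & \gamma\quad\text{subject to}\\ & \nu^{-1}\rho\ge\bar\Pi^{-1}\nu^{-1},\quad \nu^{-1}\ge 0,\quad \kappa\ge 0,\\ & \nu^{-1}b_j(y)y-\nu^{-1}\rho\, b_j(x)x+(x-z)F_j(x)-(y-z)F_j(x+1)\ge 0,\quad \forall(x,y,z)\in\mathcal{I}(n),\ \forall j\in\{1,\dots,m\},\\ & b_j(y)y-\gamma b_j(x)x+(x-z)F_j(x)-(y-z)F_j(x+1)+\kappa\Big[\sum_{k=1}^xF_j(k)-\sum_{k=1}^yF_j(k)\Big]\ge 0,\\ &\hspace{6cm}\forall(x,y,z)\in\mathcal{I}(n),\ \forall j\in\{1,\dots,m\},\end{aligned}$$ where $\mathcal{I}(n)=\{(x,y,z)\in\{0,1,\dots,n\}^3:1\le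 x+y-z\le n,\ z\le\min\{x,y\}\}$ and $b_j(0)=F_j(0)=F_j(n+1)=0$. Then the (linear) local taxation rule $T^{\rm opt}$ defined by $T^{\rm opt}(b_j)(x)=F^{\rm opt}_j(x)-b_j(x)$, $j=1,\dots,m$, achieves Price of Anarchy ${\rm PoA}(\mathcal{G}^n_{T^{\rm opt}})=1/\rho^{\rm opt}\le\bar\Pi$ and Price of Stability ${\rm PoS}(\mathcal{G}^n_{T^{\rm opt}})\le 1/\gamma^{\rm opt}$.
   Context: A (taxed, atomic) congestion game consists of users $N$, a set of resources $\mathcal{E}$, for each user $i$ a set of feasible actions $\mathcal{A}_i\subseteq 2^{\mathcal{E}}$, and for each resource $e$ a resource cost function $\ell_e:\{1,\dots,n\}\to\mathbb{R}$ and a tax function $\tau_e:\{1,\dots,n\}\to\mathbb{R}$. For an assignment $a\in\mathcal{A}=\prod_{i\in N}\mathcal{A}_i$, let $|a|_e$ be the number of users $i$ with $e\in a_i$. The system cost is ${\rm SC}(a)=\sum_{i\in N}\sum_{e\in a_i}\ell_e(|a|_e)$ (taxes excluded), and user $i$ incurs cost $C_i(a)=\sum_{e\in a_i}[\ell_e(|a|_e)+\tau_e(|a|_e)]$. A pure Nash equilibrium is an $a^{\rm ne}\in\mathcal{A}$ with $C_i(a^{\rm ne})\le C_i(a_i,a^{\rm ne}_{-i})$ for all $a_i\in\mathcal{A}_i$, $i\in N$; ${\rm NE}(G)$ is the (always nonempty) set of pure Nash equilibria of $G$, and ${\rm MinCost}(G)=\min_{a\in\mathcal{A}}{\rm SC}(a)$.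 For a family $\mathcal{G}$ of games, $${\rm PoA}(\mathcal{G})=\sup_{G\in\mathcal{G}}\max_{a\in{\rm NE}(G)}\frac{{\rm SC}(a)}{{\rm MinCost}(G)},\qquad {\rm PoS}(\mathcal{G})=\sup_{G\in\mathcal{G}}\min_{a\in{\rm NE}(G)}\frac{{\rm SC}(a)}{{\rm MinCost}(G)}.$$ A local taxation rule is a map $T$ assigning to each $\ell\in\mathcal{L}$ a tax function $T(\ell):\{1,\dots,n\}\to\mathbb{R}$. $\mathcal{G}^n_T$ is the family of all congestion games with at most $n$ users, all resource costs $\ell_e\in\mathcal{L}$, and taxes $\tau_e=T(\ell_e)$. A local rule is linear if $T(\sum_j\alpha_jb_j)=\sum_j\alpha_jT(b_j)$ for all $\alpha_j\ge0$. ${\rm MinPoA}(n,\mathcal{L})=\min_T{\rm PoA}(\mathcal{G}^n_T)$, the minimum over all local taxation rules.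
   Formalization: The equality PoA = 1/ρ^opt is stated only when ρ^opt is the largest ratio the program allows for the given F^opt, γ^opt, κ^opt (it fails for other solutions); for every solution PoA ≤ 1/ρ^opt ≤ Π̄ holds, and some solution with the same F^opt, γ^opt, κ^opt attains the largest ratio. *)

(* Defs.v *)
From HB Require Import structures.
From mathcomp Require Import all_boot all_order all_algebra.
From mathcomp Require Import boolp classical_sets reals constructive_ereal ereal.

Set Implicit Arguments.
Unset Strict Implicit.
Unset Printing Implicit Defensive.

Import Order.TTheory GRing.Theory Num.Theory.

Local Open Scope classical_set_scope.
Local Open Scope ring_scope.

(* A function {1,...,n} -> R is stored as [f : {ffun 'I_n -> R}], the value at
   k being [f] at the ordinal k - 1. [at1 f k] reads it back at k and is 0 for
   k outside {1,...,n}, so that f(0) = f(n+1) = 0. *)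
Definition at1 (R : realType) (n : nat) (f : {ffun 'I_n -> R}) (k : nat) : R :=
  if k is k'.+1 then oapp f 0 (insub k' : option 'I_n) else 0.

Definition lincomb (R : realType) (n m : nat) (alpha : 'I_m -> R)
    (f : 'I_m -> {ffun 'I_n -> R}) : {ffun 'I_n -> R} :=
  [ffun k => \sum_(j < m) alpha j * f j k].

(* Nonnegative coefficients only: this is a convex cone. *)
Definition nnspan (R : realType) (n m : nat) (b : 'I_m -> {ffun 'I_n -> R}) :
    set {ffun 'I_n -> R} :=
  [set l | exists2 alpha : 'I_m -> R,
             (forall j, 0 <= alpha j) & l = lincomb alpha b].

(* Taxed atomic congestion games with at most n users; users and resources are
   numbered. *)
Record game (R : realType) (n : nat) := Game {
  users : nat;
  resources : nat;
  users_le : (users <= n)%N;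
  actions : 'I_users -> {set {set 'I_resources}};
  actions_nonempty : forall i, actions i != finset.set0;
  cost : 'I_resources -> {ffun 'I_n -> R};
  tax : 'I_resources -> {ffun 'I_n -> R}
}.

Section GameDefs.
Context (R : realType) (n : nat) (G : game R n).

Local Notation user := 'I_(users G).
Local Notation resource := 'I_(resources G).

Definition assignment : Type := {ffun user -> {set resource}}.

Definition feasible (a : assignment) : Prop :=
  forall i, a i \in actions i.

Definition load (a : assignment) (e : resource) : nat :=
  #|[pred i | e \in a i]|.

Definition system_cost (a : assignment) : R :=
  \sum_i \sum_(e in a i) at1 (cost e) (load a e).

Definition user_cost (i : user) (a : assignment) : R :=
  \sum_(e in a i) (at1 (cost e) (load a e) + at1 (tax e) (load a e)).

Definition deviate (a : assignment) (i : user) (s : {set resource}) :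
    assignment :=
  [ffun j => if j == i then s else a j].

Definition pure_nash : set assignment :=
  [set a | feasible a /\
           forall i s, s \in actions i ->
             user_cost i a <= user_cost i (deviate a i s)].

(* The infimum of a nonempty finite set, i.e. a minimum. *)
Definition min_cost : R :=
  inf [set system_cost a | a in [set a | feasible a]].

(* SC(a) / MinCost(G). When MinCost(G) = 0, an assignment of minimum cost has
   ratio 1 and any other one has ratio +oo. *)
Definition efficiency (a : assignment) : \bar R :=
  if min_cost == 0 then (if system_cost a == 0 then 1%E else +oo%E)
  else (system_cost a / min_cost)%:E.

End GameDefs.

(* The set of pure Nash equilibria of a game is finite and nonempty, so the
   inner supremum and infimum below are a maximum and a minimum. *)
Definition PoA (R : realType) (n : nat) (GG : set (game R n)) : \bar R :=
  ereal_sup [set ereal_sup [set efficiency a | a in pure_nash (G := G)]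
            | G in GG].

Definition PoS (R : realType) (n : nat) (GG : set (game R n)) : \bar R :=
  ereal_sup [set ereal_inf [set efficiency a | a in pure_nash (G := G)]
            | G in GG].

(* Only the values of a local taxation rule on the cost family matter. *)
Definition local_rule (R : realType) (n : nat) : Type :=
  {ffun 'I_n -> R} -> {ffun 'I_n -> R}.

Definition taxed_games (R : realType) (n : nat) (L : set {ffun 'I_n -> R})
    (T : local_rule R n) : set (game R n) :=
  [set G | forall e : 'I_(resources G), L (cost e) /\ tax e = T (cost e)].

Definition linear_rule (R : realType) (n m : nat)
    (b : 'I_m -> {ffun 'I_n -> R}) (T : local_rule R n) : Prop :=
  forall alpha : 'I_m -> R, (forall j, 0 <= alpha j) ->
    T (lincomb alpha b) = lincomb alpha (fun j => T (b j)).

Definition MinPoA (R : realType) (n : nat) (L : set {ffun 'I_n -> R}) :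
    \bar R :=
  ereal_inf [set PoA (taxed_games L T) | T in [set: local_rule R n]].

Definition index_set (n x y z : nat) : bool :=
  [&& (x <= n)%N, (y <= n)%N, (z <= n)%N,
      (1 <= x + y - z <= n)%N & (z <= minn x y)%N].

(* [nurho] stands for the single variable nu^-1 rho, [nuinv] for nu^-1. *)
Definition program_feasible (R : realType) (n m : nat)
    (b : 'I_m -> {ffun 'I_n -> R}) (Pibar : R)
    (F : 'I_m -> {ffun 'I_n -> R}) (nurho gamma nuinv kappa : R) : Prop :=
  [/\ Pibar^-1 * nuinv <= nurho,
      0 <= nuinv,
      0 <= kappa,
      forall x y z, index_set n x y z -> forall j : 'I_m,
        0 <= nuinv * at1 (b j) y * y%:R - nurho * at1 (b j) x * x%:R
             + (x%:R - z%:R) * at1 (F j) x - (y%:R - z%:R) * at1 (F j) x.+1 &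
      forall x y z, index_set n x y z -> forall j : 'I_m,
        0 <= at1 (b j) y * y%:R - gamma * at1 (b j) x * x%:R
             + (x%:R - z%:R) * at1 (F j) x - (y%:R - z%:R) * at1 (F j) x.+1
             + kappa * (\sum_(1 <= k < x.+1) at1 (F j) k
                        - \sum_(1 <= k < y.+1) at1 (F j) k)].

Definition program_solution (R : realType) (n m : nat)
    (b : 'I_m -> {ffun 'I_n -> R}) (Pibar : R)
    (F : 'I_m -> {ffun 'I_n -> R}) (nurho gamma nuinv kappa : R) : Prop :=
  program_feasible b Pibar F nurho gamma nuinv kappa /\
  forall F' nurho' gamma' nuinv' kappa',
    program_feasible b Pibar F' nurho' gamma' nuinv' kappa' -> gamma' <= gamma.

(* The objective of the program ignores nu^-1 rho and nu^-1, so for a given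
   optimal F the ratio rho need not be unique: unless the constraint
   rho >= 1 / Pibar forces it, rho can be lowered without affecting
   optimality. This predicate says that rho is the largest ratio the program
   allows for the given F, gamma and kappa. *)
Definition rho_maximal (R : realType) (n m : nat)
    (b : 'I_m -> {ffun 'I_n -> R}) (Pibar : R)
    (F : 'I_m -> {ffun 'I_n -> R}) (nurho gamma nuinv kappa : R) : Prop :=
  forall nurho' nuinv', 0 < nuinv' ->
    program_feasible b Pibar F nurho' gamma nuinv' kappa ->
    nurho' / nuinv' <= nurho / nuinv.

(* Main.v *)
(* Weighted by the program's multipliers and summed over the resources, the
   first block of constraints together with the equilibrium inequalities for
   the deviations to an optimal assignment gives
   nu^-1 rho SC(ne) <= nu^-1 MinCost. The second block does the same for the
   equilibrium that minimizes Rosenthal's potential, whose comparison with the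
   optimum is the term in kappa.

   Conversely, let PoA(T) <= 1 / c. If no multiplier nu satisfied the first
   block with rho = c and F = nu (b + T b), one-variable LP duality would give
   two violated triples (x, y, z) with integer weights, and these are the
   resource types of a rotationally symmetric game contradicting
   PoA(T) <= 1 / c. Closedness of projections of polyhedra turns
   MinPoA <= Pibar, an infimum, into a feasible point with rho = 1 / Pibar and
   nu = 1; taking kappa = 0 there shows gamma >= 1 / Pibar > 0 at the optimum,
   which rules out nu^-1 = 0.

   Costs of either sign are allowed: a solution exists only if some cost is
   positive, and if another one is negative the diagonal triples (k, k, k) force
   rho = gamma = 1. *)
Require Import Defs.
From mathcomp Require Import all_boot all_order all_algebra.
From mathcomp Require Import boolp classical_sets reals constructive_ereal ereal.
From mathcomp Require Import ring lra zify.

Import Order.TTheory GRing.Theory Num.Theory.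
Local Open Scope ring_scope.

(** * Linear inequalities *)

(** Positive coefficients bound [t] from below by [- c k / a k], negative ones from above; the
    pairwise condition puts the largest lower bound under every upper bound. *)
Lemma one_variable_feasible (R : realFieldType) (K : finType) (a c : K -> R) :
    (forall k, a k = 0 -> 0 <= c k) ->
    (forall i j, 0 < a i -> a j < 0 -> 0 <= a i * c j - a j * c i) ->
  exists t, forall k, 0 <= a k * t + c k.
Proof.
move=> c0 cpn; case: (pickP (fun k => 0 < a k)) => [i0 ai0|nopos].
  case: (@Order.TotalTheory.arg_maxP _ _ _ i0 (fun k => 0 < a k)
    (fun k => - c k / a k) ai0) => i ai imax.
  exists (- c i / a i) => k; have [ak|ak|/[dup] ak /c0] := ltgtP (a k) 0.
  - rewrite (_ : _ + _ = (a i * c k - a k * c i) / a i); last by field; lra.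
    by rewrite divr_ge0 ?cpn// ltW.
  - have := imax _ ak; rewrite /= ler_pdivrMr//; lra.
  - by rewrite ak mul0r add0r.
case: (pickP (fun k => a k < 0)) => [i0 ai0|noneg].
  case: (@Order.TotalTheory.arg_minP _ _ _ i0 (fun k => a k < 0)
    (fun k => - c k / a k) ai0) => i ai imin.
  exists (- c i / a i) => k; have [ak|ak|/[dup] ak /c0] := ltgtP (a k) 0.
  - have := imin _ ak; rewrite /= ler_ndivlMr//; lra.
  - by rewrite nopos in ak.
  - by rewrite ak mul0r add0r.
exists 0 => k; rewrite mulr0 add0r; apply: c0; apply/eqP.
by rewrite eq_le !leNgt nopos noneg.
Qed.

(** The solutions may be unbounded as [e] tends to 0, so compactness is avoided: Fourier-Motzkin
    elimination reduces to a system without variables, where the limit is immediate. *)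
Lemma polyhedron_limit (R : realFieldType) (N : nat) (K : finType)
    (a : K -> nat -> R) (c d : K -> R) :
    (forall e, 0 < e -> exists v : nat -> R,
      forall k, 0 <= \sum_(i < N) a k i * v i + c k + e * d k) ->
  exists v : nat -> R, forall k, 0 <= \sum_(i < N) a k i * v i + c k.
Proof.
elim: N => [|N IHN] in K a c d * => limP.
  exists (fun=> 0) => k; rewrite big_ord0 add0r leNgt; apply/negP => ck.
  have dk : 0 < `|d k| + 1 by have := normr_ge0 (d k); lra.
  have [|v /(_ k)] := limP (- c k / (2 * (`|d k| + 1))).
    by rewrite divr_gt0 ?oppr_gt0// mulr_gt0.
  rewrite big_ord0 add0r; apply/negP; rewrite -ltNge.
  have := ler_norm (d k).
  have e0 : 0 < - c k / (2 * (`|d k| + 1)).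
    by rewrite divr_gt0 ?oppr_gt0// mulr_gt0.
  move: e0; set e := _ / _ => e0 dle.
  have ee : e * (2 * (`|d k| + 1)) = - c k by rewrite /e; field; lra.
  nra.
(* A positive and a negative coefficient of variable [N] are made to cancel. Any other pair keeps
   its first inequality if variable [N] is absent from it, and becomes trivial otherwise. *)
pose p (ij : K * K) := if (0 < a ij.1 N) && (a ij.2 N < 0) then - a ij.2 N
  else (a ij.1 N == 0)%:R.
pose q (ij : K * K) := if (0 < a ij.1 N) && (a ij.2 N < 0) then a ij.1 N else 0.
pose comb (f : K -> R) ij := p ij * f ij.1 + q ij * f ij.2.
have p0 ij : 0 <= p ij by rewrite /p; case: ifP => [/andP[]|]; rewrite ?ler0n//; lra.
have q0 ij : 0 <= q ij by rewrite /q; case: ifP => // /andP[]; lra.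
have pq0 ij : p ij * a ij.1 N + q ij * a ij.2 N = 0.
  rewrite /p /q; case: ifP => _; first ring.
  by case: eqP => [->|_]; rewrite ?mulr0 !mul0r addr0.
have combS ij (v : nat -> R) : \sum_(i < N) comb (a^~ i) ij * v i =
    p ij * (\sum_(i < N) a ij.1 i * v i) + q ij * (\sum_(i < N) a ij.2 i * v i).
  rewrite !mulr_sumr -big_split; apply: eq_bigr => i _; rewrite /comb /=; ring.
have [e e0|v vP] := IHN _ (fun ij i => comb (a^~ i) ij) (comb c) (comb d).
  have [v vP] := limP _ e0; exists v => ij; rewrite combS.
  have := addr_ge0 (mulr_ge0 (p0 ij) (vP ij.1)) (mulr_ge0 (q0 ij) (vP ij.2)).
  rewrite !big_ord_recr /= /comb.
  have := pq0 ij.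
  set A := \sum_(_ < _) _; set B := \sum_(_ < _) _ => h.
  set X := (X in X <= _ -> _); set Y := (Y in _ <= Y -> _).
  suff -> : Y = p ij * A + q ij * B + (p ij * c ij.1 + q ij * c ij.2) +
    e * (p ij * d ij.1 + q ij * d ij.2) + v N * (p ij * a ij.1 N + q ij * a ij.2 N).
    by rewrite h mulr0 addr0.
  by rewrite /Y; ring.
have [k ak|i j ai aj|t tP] := @one_variable_feasible _ K (a^~ N)
    (fun k => \sum_(i < N) a k i * v i + c k).
- by have := vP (k, k); rewrite combS /comb /p /q /= ak ltxx /= eqxx !mul1r !mul0r !addr0.
- have := vP (i, j); rewrite combS /comb /p /q /= ai aj /=; lra.
exists (fun i => if i == N then t else v i) => k.
rewrite big_ord_recr /= eqxx.
under eq_bigr => i _ do rewrite (ltn_eqF (ltn_ord i)).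
have := tP k; lra.
Qed.

(** Once [q] exceeds [1 / (v - u)], the interval from [q * u] to [q * v] is longer than 1, so the
    first integer above [q * u] lies in it. *)
Lemma nat_between (R : archiRealFieldType) (u v : R) : 0 <= u -> u < v ->
  exists p q : nat, q%:R * u < p%:R <= q%:R * v.
Proof.
move=> u0 uv; pose q := Num.bound ((v - u)^-1).
have qP : 1 < q%:R * (v - u).
  rewrite -ltr_pdivrMr ?subr_gt0// mul1r; apply: archi_boundP.
  by rewrite invr_ge0 subr_ge0 ltW.
exists (Num.truncn (q%:R * u)).+1, q.
have qu0 : 0 <= q%:R * u by rewrite mulr_ge0.
have /andP[h1 h2] := truncn_itv qu0.
by rewrite h2 /= -natr1; lra.
Qed.

(* Multipliers can be taken to be integers because the violated inequality is
   strict; as multiplicities of resources they must be integers, since a local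
   rule need not commute with scaling. *)
Lemma farkas_nat (R : archiRealFieldType) (I : finType) (g h : I -> R) :
    (forall i j (p q : nat), p%:R * h i + q%:R * h j <= 0 ->
      0 <= p%:R * g i + q%:R * g j) ->
  exists2 s, 0 <= s & forall i, 0 <= g i + s * h i.
Proof.
move=> gh.
have g0 i : h i <= 0 -> 0 <= g i by have := gh i i 1%N 0%N; rewrite !mul1r !mul0r !addr0.
have [[i|] //=|[i|] [j|] //=|s sP] := @one_variable_feasible R (option I)
    (fun o => if o is Some i then h i else 1) (fun o => if o is Some i then g i else 0).
- by move=> hi; apply: g0; rewrite hi.
- move=> hi hj; rewrite leNgt; apply/negP => lt0.
  have gj := g0 _ (ltW hj).
  have gi : g i < 0 by nra.
  (* Such a ratio [p / q] makes [p * h i + q * h j <= 0] but [p * g i + q * g j < 0], against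
     [gh]. *)
  have [||p [q /andP[]]] := @nat_between R (g j / - g i) (- h j / h i).
  + by rewrite divr_ge0//; lra.
  + by rewrite ltr_pdivrMr ?oppr_gt0// mulrAC ltr_pdivlMr//; lra.
  rewrite mulrA ltr_pdivrMr ?oppr_gt0// mulrA ler_pdivlMr// => lo hi'.
  have := gh i j p q; lra.
- by rewrite ltr10.
- by move=> _ hj; rewrite mul1r mulr0 subr0; apply: g0 (ltW hj).
exists s; first by have := sP None; rewrite /= mul1r addr0.
by move=> i; have := sP (Some i); rewrite /= mulrC addrC.
Qed.

(** * Congestion games *)

Section Games.
Context {R : realType} {n : nat} (G : game R n).
Implicit Types (a : assignment G) (i : 'I_(users G)) (e : 'I_(resources G)).

Definition perceived_cost e k : R := at1 (cost e) k + at1 (tax e) k.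

(** This is the [z] of a triple in [index_set] whose [x] and [y] are the two loads. *)
Definition common_load a a' e : nat := #|[pred i | (e \in a i) && (e \in a' i)]|.

Definition load_without a i e : nat := #|[pred i' | (i' != i) && (e \in a i')]|.

Definition potential a : R :=
  \sum_e \sum_(1 <= k < (load a e).+1) perceived_cost e k.

Lemma load_withoutE a i e : load a e = ((e \in a i) + load_without a i e)%N.
Proof.
by rewrite /load (cardD1 i) inE.
Qed.

Lemma load_without_deviate a i s e :
  load_without (deviate a i s) i e = load_without a i e.
Proof. by apply: eq_card => k; rewrite !inE ffunE; case: eqP. Qed.

Lemma load_deviate a i (s : {set 'I_(resources G)}) e : e \in s ->
  load (deviate a i s) e = (load a e + (e \notin a i))%N.
Proof.
move=> es; rewrite (load_withoutE _ i) load_without_deviate ffunE eqxx es.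
by rewrite (load_withoutE a i); case: (e \in a i); rewrite /= ?addn0 ?addn1.
Qed.

Lemma sum_actions a (phi : 'I_(resources G) -> R) :
  \sum_i \sum_(e in a i) phi e = \sum_e (load a e)%:R * phi e.
Proof.
rewrite (exchange_big_dep predT)//=; apply: eq_bigr => e _.
by rewrite sumr_const mulr_natl.
Qed.

Lemma system_costE a : system_cost a = \sum_e (load a e)%:R * at1 (cost e) (load a e).
Proof. exact: sum_actions. Qed.

Lemma common_load_le a a' e : (common_load a a' e <= minn (load a e) (load a' e))%N.
Proof.
by rewrite leq_min; apply/andP; split; apply: subset_leq_card; apply/fintype.subsetP => i;
  rewrite !inE => /andP[].
Qed.

Lemma loadU_le a a' e : (load a e + load a' e - common_load a a' e <= n)%N.
Proof.
rewrite -cardUI addnK; apply: leq_trans (users_le G).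
by rewrite -[X in (_ <= X)%N]card_ord max_card.
Qed.

Lemma load_le a e : (load a e <= n)%N.
Proof. by rewrite (leq_trans (max_card _))// card_ord users_le. Qed.

Lemma load_index_set a a' e : (0 < load a e + load a' e)%N ->
  index_set n (load a e) (load a' e) (common_load a a' e).
Proof.
have := common_load_le a a' e; have := loadU_le a a' e.
have := load_le a e; have := load_le a' e.
rewrite /index_set leq_min; lia.
Qed.

(** User [i] deviates to [a' i], and the inequalities are summed over [i]. On a resource with loads
    [x] and [y], the [z] common users still meet load [x]; the other [y - z] deviators meet
    [x + 1]. *)
Lemma nash_deviation_sum a a' : pure_nash a -> feasible a' ->
  \sum_e (((load a e)%:R - (common_load a a' e)%:R) * perceived_cost e (load a e)
    - ((load a' e)%:R - (common_load a a' e)%:R) * perceived_cost e (load a e).+1) <= 0.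
Proof.
move=> [_ nasha] feas.
have : \sum_i user_cost i a <= \sum_i user_cost i (deviate a i (a' i)).
  by apply: ler_sum => i _; exact: nasha (feas i).
rewrite [X in X <= _](sum_actions a (fun e => perceived_cost e (load a e))).
rewrite (_ : \sum_i user_cost i (deviate a i (a' i)) =
  \sum_e ((common_load a a' e)%:R * perceived_cost e (load a e) +
  ((load a' e)%:R - (common_load a a' e)%:R) * perceived_cost e (load a e).+1)).
  rewrite -subr_le0 -sumrB => le0; rewrite (le_trans _ le0)//.
  by apply: ler_sum => e _; lra.
transitivity (\sum_i \sum_(e in a' i) perceived_cost e (load a e + (e \notin a i))).
  apply: eq_bigr => i _; rewrite /user_cost.
  rewrite {1}/deviate ffunE eqxx; apply: eq_bigr => e ea'.
  by rewrite load_deviate.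
rewrite (exchange_big_dep predT)//=; apply: eq_bigr => e _.
rewrite (bigID (fun i => e \in a i)) /=; congr (_ + _).
  rewrite (eq_bigr (fun=> perceived_cost e (load a e))).
    rewrite sumr_const mulr_natl; congr (_ *+ _).
    by apply: eq_card => i; rewrite !inE andbC.
  by move=> i /andP[_ ->]; rewrite addn0.
rewrite (eq_bigr (fun=> perceived_cost e (load a e).+1)); last first.
  by move=> i /andP[_ ->]; rewrite addn1.
rewrite sumr_const -[LHS]mulr_natl; congr (_ * _).
apply/eqP; rewrite eq_sym subr_eq -natrD; apply/eqP; congr (_%:R).
rewrite /load -(cardID [pred i | e \in a i] [pred i | e \in a' i]) addnC.
by congr addn; apply: eq_card => i; rewrite !inE// andbC.
Qed.

(** User [i] is counted last on each of its resources. The remainder does not depend on its action,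
    so a deviation changes potential and user cost equally. *)
Lemma potential_user_cost a i : potential a = user_cost i a +
  \sum_e \sum_(1 <= k < (load_without a i e).+1) perceived_cost e k.
Proof.
rewrite /user_cost big_mkcond -big_split; apply: eq_bigr => e _ /=.
rewrite (load_withoutE a i); case: (e \in a i) => /=; last by rewrite add0r.
by rewrite big_nat_recr//= addrC add1n.
Qed.

Lemma min_potential_nash a : feasible a ->
  (forall a', feasible a' -> potential a <= potential a') -> pure_nash a.
Proof.
move=> fa mina; split=> // i s si.
have : feasible (deviate a i s).
  by move=> j; rewrite ffunE; case: eqP => [->|].
move/mina; rewrite (potential_user_cost a i) (potential_user_cost (deviate a i s) i).
by under [X in _ <= _ + X]eq_bigr => e _ do rewrite load_without_deviate; rewrite lerD2r.
Qed.

Lemma feasible_argmin (f : assignment G -> R) :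
  exists2 a, feasible a & forall a', feasible a' -> f a <= f a'.
Proof.
have [a0 fa0] : exists a0 : assignment G, [forall i, a0 i \in actions i].
  pose pick_action i := odflt finset.set0 [pick s in actions i].
  exists [ffun i => pick_action i]; apply/forallP => i; rewrite ffunE /pick_action.
  case: pickP => [//|none]; have /set0Pn[s] := actions_nonempty i.
  by rewrite none.
case: (@arg_minP _ _ _ a0 (fun a => [forall i, a i \in actions i]) f fa0) => a fa mina.
exists a; first by move=> i; exact: (forallP fa).
by move=> a' fa'; apply: mina; apply/forallP.
Qed.

Lemma min_cost_attained : exists2 a : assignment G, feasible a & min_cost G = system_cost a.
Proof.
have [a fa mina] := feasible_argmin (@system_cost R n G).
exists a => //; apply/le_anti/andP; split.
  by apply: ge_inf; [exists (system_cost a) => _ [a' /= fa' <-]; exact: mina | exists a].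
by apply: lb_le_inf; [exists (system_cost a), a | move=> _ [a' /= fa' <-]; exact: mina].
Qed.

Lemma min_cost_le a : feasible a -> min_cost G <= system_cost a.
Proof.
move=> fa; have [a0 fa0 mina0] := feasible_argmin (@system_cost R n G).
by apply: ge_inf; [exists (system_cost a0) => _ [a' /= fa' <-]; exact: mina0 | exists a].
Qed.

(** The bound [c <= 1] serves the cases where the minimum is not positive: a negative one gives a
    ratio of at most 1, and a zero one forces [system_cost a = 0], of ratio 1 by convention. *)
Lemma efficiency_le (c : R) a : 0 < c -> c <= 1 -> feasible a ->
  c * system_cost a <= min_cost G -> (efficiency a <= (c^-1)%:E)%E.
Proof.
move=> c0 c1 /min_cost_le; rewrite /efficiency => minle cle.
have c1' : 1 <= c^-1 by rewrite invf_ge1.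
case: eqP => [min0|/eqP min0].
  case: eqP => [_|sc0]; first by rewrite lee_fin.
  case: sc0; apply/le_anti; rewrite -[X in _ && (X <= _)]min0 minle andbT.
  by rewrite -(pmulr_rle0 _ c0) -min0.
rewrite lee_fin; have [min_neg|min_pos|] := ltgtP (min_cost G) 0.
- by rewrite ler_ndivrMr//; nra.
- by rewrite ler_pdivrMr// mulrC ler_pdivlMr// mulrC.
- by move/eqP; rewrite (negPf min0).
Qed.

Lemma le_of_efficiency_le (c : R) a : 0 < c -> 0 <= min_cost G ->
  (efficiency a <= (c^-1)%:E)%E -> c * system_cost a <= min_cost G.
Proof.
move=> c0 min_ge0; rewrite /efficiency; case: eqP => [->|/eqP min0].
  by case: eqP => [->|]; rewrite ?mulr0.
have min_pos : 0 < min_cost G by rewrite lt_def min0.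
by rewrite lee_fin ler_pdivrMr// mulrC ler_pdivlMr// mulrC.
Qed.

Lemma smooth_system_cost (A B kappa : R) a a' :
    (forall e x y z, index_set n x y z ->
      0 <= A * at1 (cost e) y * y%:R - B * at1 (cost e) x * x%:R
           + (x%:R - z%:R) * perceived_cost e x
           - (y%:R - z%:R) * perceived_cost e x.+1
           + kappa * (\sum_(1 <= k < x.+1) perceived_cost e k
                      - \sum_(1 <= k < y.+1) perceived_cost e k)) ->
    pure_nash a -> feasible a' -> kappa * potential a <= kappa * potential a' ->
  B * system_cost a <= A * system_cost a'.
Proof.
move=> smooth nasha feas pot.
pose x e := load a e; pose y e := load a' e; pose z e := common_load a a' e.
have term_ge0 e : 0 <= A * at1 (cost e) (y e) * (y e)%:R - B * at1 (cost e) (x e) * (x e)%:R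
    + ((x e)%:R - (z e)%:R) * perceived_cost e (x e)
    - ((y e)%:R - (z e)%:R) * perceived_cost e (x e).+1
    + kappa * (\sum_(1 <= k < (x e).+1) perceived_cost e k
               - \sum_(1 <= k < (y e).+1) perceived_cost e k).
  (* A resource used in neither assignment lies outside [index_set], but its term is 0. *)
  case: (posnP (x e + y e)%N) => [/eqP|/load_index_set]; last exact: smooth.
  have := common_load_le a a' e; rewrite -/(x e) -/(y e) -/(z e).
  rewrite addn_eq0 => zle /andP[/eqP x0 /eqP y0].
  move: zle; rewrite x0 y0 leqn0 => /eqP ->.
  by rewrite !big_geq// !subr0 !mul0r !mulr0 subrr !addr0.
have : 0 <= A * system_cost a' - B * system_cost a
    + \sum_e (((x e)%:R - (z e)%:R) * perceived_cost e (x e)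
              - ((y e)%:R - (z e)%:R) * perceived_cost e (x e).+1)
    + kappa * (potential a - potential a').
  rewrite !system_costE /potential -sumrB !mulr_sumr -sumrB -!big_split /=.
  rewrite sumr_ge0// => e _; rewrite (le_trans (term_ge0 e))// le_eqVlt; apply/orP; left.
  by apply/eqP; rewrite /x /y; ring.
have := nash_deviation_sum _ _ nasha feas; rewrite -/x -/y -/z.
move: pot; lra.
Qed.

End Games.

(** * The worst-case game *)

Lemma card_ord_itv (N a b : nat) : (b <= N)%N ->
  #|[pred k : 'I_N | (a <= k < b)%N]| = (b - a)%N.
Proof.
move=> bN; rewrite -sum1_card -[RHS](muln1) -sum_nat_const_nat.
rewrite (@big_nat_widen _ _ _ a b N predT)//= big_geq_mkord.
by apply: eq_bigl => k; rewrite /= inE andbC.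
Qed.

Lemma card_rotate (N : nat) (P : pred 'I_N.+1) (c : 'I_N.+1) :
  #|[pred i | P (i - c)]| = #|P|.
Proof.
rewrite -!sum1_card (reindex (fun i => i + c)) /=; last first.
  by exists (fun i => i - c) => i _; rewrite ?addrK ?subrK.
by apply: eq_bigl => i; rewrite !inE addrK.
Qed.

(** Subtraction in ['I_N.+1] is cyclic, so user [i] meets each type at every position exactly once,
    and the sum is the same for all users. *)
Lemma sum_rotate (R : realType) (N : nat) (T : finType) (P : T -> pred 'I_N.+1)
    (phi : T -> 'I_N.+1 -> R) (i : 'I_N.+1) :
  let pos (r : 'I_#|{: T * 'I_N.+1}|) := i - (enum_val r).2 in
  \sum_(r | P (enum_val r).1 (pos r)) phi (enum_val r).1 (pos r) =
  \sum_t \sum_(k | P t k) phi t k.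
Proof.
move=> pos.
transitivity (\sum_(tc : T * 'I_N.+1 | P tc.1 (i - tc.2)) phi tc.1 (i - tc.2)).
  rewrite [RHS](reindex (fun r : 'I_#|{: T * 'I_N.+1}| => enum_val r))//.
  exact/onW_bij/enum_val_bij.
rewrite -(pair_big_dep predT (fun t c => P t (i - c)) (fun t c => phi t (i - c))) /=.
apply: eq_bigr => t _; rewrite [RHS](reindex_inj (can_inj (subKr i))).
by [].
Qed.

(* Resource (t, c) sits at position i - c mod n of user i, who uses it in the
   equilibrium at the positions [0, x) and in the optimum at the positions
   [x - z, x - z + y). By symmetry all users face the same costs. *)
Lemma rotation_game (R : realType) (n : nat) (T : finType) (x y z : T -> nat)
    (c tau : T -> {ffun 'I_n -> R}) :
    (0 < n)%N -> (forall t, index_set n (x t) (y t) (z t)) ->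
    let f t k := at1 (c t) k + at1 (tau t) k in
    \sum_t (((x t)%:R - (z t)%:R) * f t (x t)
            - ((y t)%:R - (z t)%:R) * f t (x t).+1) <= 0 ->
  exists G : game R n,
    (forall e, exists t, cost (g := G) e = c t /\ tax (g := G) e = tau t) /\
    exists a a' : assignment G,
      [/\ pure_nash a, feasible a',
          system_cost a = n%:R * \sum_t (x t)%:R * at1 (c t) (x t) &
          system_cost a' = n%:R * \sum_t (y t)%:R * at1 (c t) (y t)].
Proof.
case: n c tau => // N c tau _ idx f sum_le0.
(* By the last bound the interval of the optimum does not wrap around, so it overlaps that of the
   equilibrium in exactly [z t] positions. *)
have idxE t : [/\ (x t <= N.+1)%N, (z t <= x t)%N, (z t <= y t)%N &
    (x t - z t + y t <= N.+1)%N].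
  have := idx t; rewrite /index_set leq_min => ?; split; lia.
pose pne t : pred 'I_N.+1 := [pred k : 'I_N.+1 | (0 <= k < x t)%N].
pose popt t : pred 'I_N.+1 := [pred k : 'I_N.+1 | (x t - z t <= k < x t - z t + y t)%N].
have card_ne t : #|pne t| = x t by have [? ? ? ?] := idxE t; rewrite card_ord_itv ?subn0.
have card_opt t : #|popt t| = y t.
  by have [? ? ? ?] := idxE t; rewrite card_ord_itv// addKn.
have card_both t : #|[pred k | popt t k && pne t k]| = z t.
  have [xn zx zy un] := idxE t.
  rewrite -[RHS](subKn zx) -(@card_ord_itv N.+1)//.
  by apply: eq_card => k; rewrite !inE /popt /pne /=; lia.
have card_diff t : #|[pred k | popt t k && ~~ pne t k]| = (y t - z t)%N.
  have [xn zx zy un] := idxE t.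
  rewrite -[in RHS](addnK (x t) (y t)) -subnDA (addnC (x t)) subnDA.
  have -> : (y t + x t - z t - x t = x t - z t + y t - x t)%N by lia.
  rewrite -(@card_ord_itv N.+1)//.
  by apply: eq_card => k; rewrite !inE /popt /pne /=; lia.
pose sel (P : T -> pred 'I_N.+1) (i : 'I_N.+1) : {set 'I_#|{: T * 'I_N.+1}|} :=
  [set r | P (enum_val r).1 (i - (enum_val r).2)].
have set_nonempty i : [set sel pne i; sel popt i] != finset.set0.
  by apply/set0Pn; exists (sel pne i); rewrite !inE eqxx.
pose G := @Game R N.+1 N.+1 _ (leqnn _) (fun i => [set sel pne i; sel popt i])
  set_nonempty (fun r => c (enum_val r).1) (fun r => tau (enum_val r).1).
exists G; split; first by move=> e; exists (enum_val e).1.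
pose a P : assignment G := [ffun i => sel P i].
have loadE P e : load (a P) e = #|P (enum_val e).1|.
  rewrite -(card_rotate _ (P (enum_val e).1) (enum_val e).2).
  by apply: eq_card => i; rewrite !inE ffunE inE.
have sum_sel P i (phi : T -> 'I_N.+1 -> R) :
    \sum_(e in sel P i) phi (enum_val e).1 (i - (enum_val e).2) =
    \sum_t \sum_(k | P t k) phi t k.
  by rewrite -(@sum_rotate _ _ _ P phi i); apply: eq_bigl => e; rewrite inE.
have costE P : system_cost (a P) = N.+1%:R * \sum_t #|P t|%:R * at1 (c t) #|P t|.
  rewrite /system_cost (eq_bigr (fun=> \sum_t #|P t|%:R * at1 (c t) #|P t|)).
    by rewrite sumr_const card_ord mulr_natl.
  move=> i _; rewrite ffunE -/(sel P i).
  under eq_bigr => e _ do rewrite loadE /=.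
  rewrite (sum_sel P i (fun t _ => at1 (c t) #|P t|)).
  by apply: eq_bigr => t _; rewrite sumr_const mulr_natl.
exists (a pne), (a popt); split.
- split=> [i|i s]; first by rewrite ffunE !inE eqxx.
  have user_cost_ne : user_cost i (a pne) = \sum_t (x t)%:R * f t (x t).
    rewrite /user_cost ffunE -/(sel pne i).
    under eq_bigr => e _ do rewrite loadE card_ne /=.
    rewrite (sum_sel pne i (fun t _ => f t (x t))).
    by apply: eq_bigr => t _; rewrite sumr_const card_ne mulr_natl.
  rewrite !inE => /orP[]/eqP->.
    rewrite (_ : deviate _ _ _ = a pne) ?user_cost_ne//.
    by apply/ffunP => k; rewrite !ffunE; case: eqP => [->|].
  rewrite user_cost_ne /user_cost {1}/deviate ffunE eqxx.
  (* The deviator raises the load exactly at the positions it did not occupy in the equilibrium. *)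
  rewrite [leRHS](eq_bigr (fun e => (fun t k => f t (x t + ~~ pne t k)%N)
    (enum_val e).1 (i - (enum_val e).2))); last first.
    move=> e eopt; rewrite load_deviate// loadE card_ne /f.
    by rewrite ffunE inE.
  rewrite (sum_sel popt i (fun t k => f t (x t + ~~ pne t k)%N)).
  rewrite -subr_le0 -sumrB (le_trans _ sum_le0)// le_eqVlt; apply/orP; left.
  apply/eqP/eq_bigr => t _; rewrite (bigID (pne t)) /=.
  rewrite [X in _ - (X + _)](eq_bigr (fun=> f t (x t))); last first.
    by move=> k /andP[_ ->]; rewrite addn0.
  rewrite [X in _ - (_ + X)](eq_bigr (fun=> f t (x t).+1)); last first.
    by move=> k /andP[_ ->]; rewrite addn1.
  have [_ _ zy _] := idxE t.
  rewrite !sumr_const card_both card_diff.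
  rewrite -[_ *+ (_ - _)]mulr_natl natrB// -[_ *+ z t]mulr_natl; ring.
- by move=> i; rewrite ffunE !inE eqxx orbT.
- by rewrite costE; congr (_ * _); apply: eq_bigr => t _; rewrite card_ne.
- by rewrite costE; congr (_ * _); apply: eq_bigr => t _; rewrite card_opt.
Qed.

(** * From the Price of Anarchy to the program *)

Lemma at1_lincomb (R : realType) (n m : nat) (alpha : 'I_m -> R)
    (f : 'I_m -> {ffun 'I_n -> R}) (k : nat) :
  at1 (lincomb alpha f) k = \sum_j alpha j * at1 (f j) k.
Proof.
case: k => [|k] /=; first by rewrite big1// => j _; rewrite mulr0.
case: insubP => [i _ _|_] /=; first by rewrite ffunE.
by rewrite big1// => j _; rewrite mulr0.
Qed.

Lemma at1_out (R : realType) (n : nat) (f : {ffun 'I_n -> R}) (k : nat) :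
  ~~ (1 <= k <= n)%N -> at1 f k = 0.
Proof. by case: k => // k kn /=; rewrite insubN. Qed.

(** Values become linear forms in [v], the shape that [polyhedron_limit] expects. *)
Lemma at1_finfun (R : realType) (n : nat) (v : nat -> R) (k : nat) :
  at1 [ffun i : 'I_n => v i] k = \sum_(i < n) (k == i.+1)%:R * v i.
Proof.
case: k => [|k] /=; first by rewrite big1// => i _; rewrite mul0r.
case: insubP => [i kn <-|kn] /=.
  rewrite ffunE (bigD1 i)//= eqxx mul1r big1 ?addr0// => l li.
  by rewrite eqSS eq_sym val_eqE (negPf li) mul0r.
rewrite big1// => i _; rewrite eqSS; case: eqP => [ki|]; last by rewrite mul0r.
by rewrite ki ltn_ord in kn.
Qed.

Lemma finfun_at1 (R : realType) (n : nat) (f : {ffun 'I_n -> R}) :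
  [ffun i : 'I_n => at1 f i.+1] = f.
Proof. by apply/ffunP => i; rewrite ffunE /= valK. Qed.

Lemma nnspan_basis (R : realType) (n m : nat) (b : 'I_m -> {ffun 'I_n -> R}) j :
  nnspan b (b j).
Proof.
exists (fun i => (i == j)%:R) => [i|]; first exact: ler0n.
apply/ffunP => k; rewrite ffunE (bigD1 j)//= eqxx mul1r big1 ?addr0// => i /negPf->.
by rewrite mul0r.
Qed.

(** The game without users belongs to every family, and its only assignment has ratio 1 by
    convention. *)
Lemma PoA_ge1 (R : realType) (n : nat) (L : set {ffun 'I_n -> R})
    (T : local_rule R n) : (1 <= PoA (taxed_games L T))%E.
Proof.
pose z (e : 'I_0) : {ffun 'I_n -> R} := [ffun=> 0].
have ne (i : 'I_0) : [set finset.set0] != finset.set0 :> {set {set 'I_0}} by case: i.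
pose G : game R n := @Game R n 0 0 (leq0n n) _ ne z z.
have SC0 (a : assignment G) : system_cost a = 0 by rewrite /system_cost big_ord0.
have min0 : min_cost G = 0 by have [a _ ->] := min_cost_attained G; apply: SC0.
pose a : assignment G := [ffun=> finset.set0].
apply: (le_trans _ (ereal_sup_ubound _)); last by exists G; [case|reflexivity].
apply: ereal_sup_ubound; exists a; first by split; case.
by rewrite /efficiency min0 SC0 eqxx.
Qed.

(* The dual of the first block of constraints: a violated dual inequality is
   realized as a game, whose resources have cost exactly b_j, so that T need
   not be linear. *)
Lemma PoA_le_feasible (R : realType) (n m : nat) (b : 'I_m -> {ffun 'I_n -> R})
    (T : local_rule R n) (c : R) :
    (0 < n)%N -> (forall j k, 0 <= at1 (b j) k) -> 0 < c ->
    (PoA (taxed_games (nnspan b) T) <= (c^-1)%:E)%E ->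
  let f j k := at1 (b j) k + at1 (T (b j)) k in
  exists2 s, 0 <= s & forall x y z, index_set n x y z -> forall j,
    0 <= at1 (b j) y * y%:R - c * at1 (b j) x * x%:R
         + s * ((x%:R - z%:R) * f j x - (y%:R - z%:R) * f j x.+1).
Proof.
move=> n0 b0 c0 PoAle f.
pose I := {t : 'I_m * ('I_n.+1 * 'I_n.+1 * 'I_n.+1) |
  index_set n t.2.1.1 t.2.1.2 t.2.2}.
pose j_ (t : I) := (val t).1; pose x_ (t : I) : nat := (val t).2.1.1.
pose y_ (t : I) : nat := (val t).2.1.2; pose z_ (t : I) : nat := (val t).2.2.
have idx t : index_set n (x_ t) (y_ t) (z_ t) by exact: (valP t).
pose g t := at1 (b (j_ t)) (y_ t) * (y_ t)%:R - c * at1 (b (j_ t)) (x_ t) * (x_ t)%:R.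
pose h t := ((x_ t)%:R - (z_ t)%:R) * f (j_ t) (x_ t)
  - ((y_ t)%:R - (z_ t)%:R) * f (j_ t) (x_ t).+1.
have [t1 t2 p q hle|s s0 sP] := farkas_nat R I g h.
  (* The game has [p] copies of one violated type and [q] of the other. *)
  pose t_ (k : 'I_p + 'I_q) := if k is inl _ then t1 else t2.
  have sumE (phi : I -> R) : \sum_k phi (t_ k) = p%:R * phi t1 + q%:R * phi t2.
    by rewrite big_sumType /= !sumr_const !card_ord !mulr_natl.
  have [|G [GT [a [a' [nasha feas SCa SCa']]]]] := @rotation_game R n _
    (x_ \o t_) (y_ \o t_) (z_ \o t_)
    (fun k => b (j_ (t_ k))) (fun k => T (b (j_ (t_ k)))) n0 (fun k => idx (t_ k)).
    by rewrite (sumE h).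
  have SC_ge0 (a0 : assignment G) : 0 <= system_cost a0.
    rewrite system_costE sumr_ge0// => e _; rewrite mulr_ge0//.
    by have [k [-> _]] := GT e.
  have min_ge0 : 0 <= min_cost G by have [a0 _ ->] := min_cost_attained G.
  have effle : (efficiency a <= (c^-1)%:E)%E.
    apply: le_trans PoAle; apply: le_trans (ereal_sup_ubound _); last first.
      exists G; last by [].
      by move=> e; have [k [-> ->]] := GT e; split; first exact: nnspan_basis.
    by apply: ereal_sup_ubound; exists a.
  have := le_trans (le_of_efficiency_le _ _ _ c0 min_ge0 effle) (min_cost_le _ _ feas).
  rewrite SCa SCa' mulrCA ler_pM2l ?ltr0n//.
  rewrite (sumE (fun t => (x_ t)%:R * at1 (b (j_ t)) (x_ t))).
  rewrite (sumE (fun t => (y_ t)%:R * at1 (b (j_ t)) (y_ t))) /g; lra.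
exists s => // x y z idxt j.
have /and5P[xn yn zn _ _] := idxt.
have idxo : index_set n (inord x : 'I_n.+1) (inord y : 'I_n.+1) (inord z : 'I_n.+1).
  by rewrite !inordK.
have := sP (exist _ (j, (inord x, inord y, inord z)) idxo).
by rewrite /g /h /j_ /x_ /y_ /z_ /= !inordK.
Qed.

(** The infimum is not known to be attained, so rules of Price of Anarchy at most [c^-1] are taken
    for [c] just below [P^-1], and the limit is passed to in the linear system. *)
Lemma MinPoA_feasible (R : realType) (n m : nat) (b : 'I_m -> {ffun 'I_n -> R})
    (P : R) :
    (0 < n)%N -> (forall j k, 0 <= at1 (b j) k) -> 0 < P ->
    (MinPoA (nnspan b) <= P%:E)%E ->
  exists F : 'I_m -> {ffun 'I_n -> R}, forall x y z, index_set n x y z -> forall j,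
    0 <= at1 (b j) y * y%:R - P^-1 * at1 (b j) x * x%:R
         + (x%:R - z%:R) * at1 (F j) x - (y%:R - z%:R) * at1 (F j) x.+1.
Proof.
move=> n0 b0 P0 MinPoAle.
have approx e : 0 < e -> exists F : 'I_m -> {ffun 'I_n -> R},
    forall x y z, index_set n x y z -> forall j,
    0 <= at1 (b j) y * y%:R - (P^-1 - e) * at1 (b j) x * x%:R
         + (x%:R - z%:R) * at1 (F j) x - (y%:R - z%:R) * at1 (F j) x.+1.
  move=> e0; have Pi0 : 0 < P^-1 by rewrite invr_gt0.
  (* The second argument keeps [c] positive when [e] is large; by the first, the constraints at [c]
     imply those at [P^-1 - e]. *)
  pose c := Num.max (P^-1 - e) (P^-1 / 2).
  have c0 : 0 < c by rewrite /c lt_max divr_gt0// orbT.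
  have cP : c < P^-1 by rewrite /c gt_max; apply/andP; split; lra.
  have : (MinPoA (nnspan b) < (c^-1)%:E)%E.
    by rewrite (le_lt_trans MinPoAle)// lte_fin -[P]invrK ltf_pV2.
  move=> /ereal_inf_lt[_ [T _ <-]] /ltW PoAle.
  have [s s0 sP] := PoA_le_feasible _ _ _ _ _ _ n0 b0 c0 PoAle.
  exists (fun j => [ffun k => s * (b j k + T (b j) k)]) => x y z idx j.
  have fE k : at1 [ffun k => s * (b j k + T (b j) k)] k =
      s * (at1 (b j) k + at1 (T (b j)) k).
    case: k => [|k] /=; first by rewrite addr0 mulr0.
    by case: insubP => [i _ _|_] /=; rewrite ?ffunE ?addr0 ?mulr0.
  rewrite !fE; have := sP _ _ _ idx j.
  have : (P^-1 - e) * (at1 (b j) x * x%:R) <= c * (at1 (b j) x * x%:R).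
    by rewrite ler_wpM2r ?mulr_ge0// /c le_max lexx.
  lra.
(* No constraint links different [j], so the limit is taken for each [F j] separately. *)
suff /fin_all_exists[F FP] : forall j, exists F : {ffun 'I_n -> R},
    forall x y z, index_set n x y z ->
    0 <= at1 (b j) y * y%:R - P^-1 * at1 (b j) x * x%:R
         + (x%:R - z%:R) * at1 F x - (y%:R - z%:R) * at1 F x.+1.
  by exists F => x y z idx j; apply: FP.
move=> j; pose K := {t : 'I_n.+1 * 'I_n.+1 * 'I_n.+1 | index_set n t.1.1 t.1.2 t.2}.
pose x_ (t : K) : nat := (val t).1.1; pose y_ (t : K) : nat := (val t).1.2.
pose z_ (t : K) : nat := (val t).2.
pose A t i : R := ((x_ t)%:R - (z_ t)%:R) * (x_ t == i.+1)%:R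
  - ((y_ t)%:R - (z_ t)%:R) * ((x_ t).+1 == i.+1)%:R.
have AE t (v : nat -> R) : \sum_(i < n) A t i * v i =
    ((x_ t)%:R - (z_ t)%:R) * at1 [ffun i : 'I_n => v i] (x_ t)
    - ((y_ t)%:R - (z_ t)%:R) * at1 [ffun i : 'I_n => v i] (x_ t).+1.
  rewrite !at1_finfun !mulr_sumr -sumrB; apply: eq_bigr => i _; rewrite /A; ring.
have [e e0|v vP] := polyhedron_limit R n K A
    (fun t => at1 (b j) (y_ t) * (y_ t)%:R - P^-1 * at1 (b j) (x_ t) * (x_ t)%:R)
    (fun t => at1 (b j) (x_ t) * (x_ t)%:R).
  have [F FP] := approx _ e0; exists (fun i => at1 (F j) i.+1) => t.
  rewrite (AE t (fun i => at1 (F j) i.+1)) finfun_at1; have := FP _ _ _ (valP t) j.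
  by rewrite -/(x_ t) -/(y_ t) -/(z_ t); lra.
exists [ffun i : 'I_n => v i] => x y z idxt.
have /and5P[xn yn zn _ _] := idxt.
have idxo : index_set n (inord x : 'I_n.+1) (inord y : 'I_n.+1) (inord z : 'I_n.+1).
  by rewrite !inordK.
have := vP (exist _ (inord x, inord y, inord z) idxo).
by rewrite AE /x_ /y_ /z_ /= !inordK//; lra.
Qed.

(** * Solutions of the program *)

Lemma perceived_cost_lincomb (R : realType) (n m : nat)
    (b F : 'I_m -> {ffun 'I_n -> R}) (T : local_rule R n) (G : game R n) e
    (alpha : 'I_m -> R) k :
    (forall (j : 'I_m) (x : nat), (1 <= x <= n)%N ->
       at1 (T (b j)) x = at1 (F j) x - at1 (b j) x) ->
    cost (g := G) e = lincomb alpha b ->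
    tax (g := G) e = lincomb alpha (fun j => T (b j)) ->
  perceived_cost G e k = \sum_j alpha j * at1 (F j) k.
Proof.
move=> TF ce te; rewrite /perceived_cost ce te !at1_lincomb -big_split /=.
apply: eq_bigr => j _; rewrite -mulrDr; congr (_ * _).
(* The constraints do reach [k = n.+1], where [TF] is silent but every [at1] is 0. *)
have [kn|kn] := boolP (1 <= k <= n)%N; first by rewrite TF// addrC subrK.
by rewrite !at1_out// addr0.
Qed.

(** The constraints are linear in the pair [(b j, F j)], so nonnegative coefficients carry them over
    to every cost in the span. *)
Lemma taxed_game_smooth (R : realType) (n m : nat)
    (b F : 'I_m -> {ffun 'I_n -> R}) (T : local_rule R n) (A B kappa : R) :
    linear_rule b T ->
    (forall (j : 'I_m) (x : nat), (1 <= x <= n)%N ->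
       at1 (T (b j)) x = at1 (F j) x - at1 (b j) x) ->
    (forall x y z, index_set n x y z -> forall j : 'I_m,
        0 <= A * at1 (b j) y * y%:R - B * at1 (b j) x * x%:R
             + (x%:R - z%:R) * at1 (F j) x - (y%:R - z%:R) * at1 (F j) x.+1
             + kappa * (\sum_(1 <= k < x.+1) at1 (F j) k
                        - \sum_(1 <= k < y.+1) at1 (F j) k)) ->
  forall G (a a' : assignment G), taxed_games (nnspan b) T G ->
    pure_nash a -> feasible a' ->
    kappa * potential G a <= kappa * potential G a' ->
  B * system_cost a <= A * system_cost a'.
Proof.
move=> Tlin TF con G a a' GT; apply: smooth_system_cost => e x y z idx.
have [[alpha alpha0 ce] te] := GT e.
rewrite ce (Tlin _ alpha0) in te.
have pE k : perceived_cost G e k = \sum_j alpha j * at1 (F j) k.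
  exact: perceived_cost_lincomb TF ce te.
have psumE w : \sum_(1 <= k < w.+1) perceived_cost G e k =
    \sum_j alpha j * \sum_(1 <= k < w.+1) at1 (F j) k.
  under eq_bigr => k _ do rewrite pE.
  by rewrite exchange_big; apply: eq_bigr => j _; rewrite mulr_sumr.
rewrite !psumE !pE ce !at1_lincomb -sumrB !mulr_sumr !mulr_suml -!sumrB -!big_split /=.
rewrite -sumrB -big_split /=.
apply: sumr_ge0 => j _; have := mulr_ge0 (alpha0 j) (con _ _ _ idx j) => /=; lra.
Qed.

Section Program.
Context {R : realType} {n m : nat} {b : 'I_m -> {ffun 'I_n -> R}} {P : R}.
Context {F : 'I_m -> {ffun 'I_n -> R}} {nurho gamma nuinv kappa : R}.

Lemma index_set_diag k : (1 <= k <= n)%N -> index_set n k k k.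
Proof. by rewrite /index_set minnn; lia. Qed.

(* Otherwise gamma could be increased forever. *)
Lemma solution_pos_cost : program_solution b P F nurho gamma nuinv kappa ->
  exists j, exists2 k, (1 <= k <= n)%N & 0 < at1 (b j) k.
Proof.
move=> [feas opt]; apply: contrapT => none.
have b_le0 j k : at1 (b j) k <= 0.
  have [kn|kn] := boolP (1 <= k <= n)%N; last by rewrite at1_out.
  by rewrite leNgt; apply/negP => bjk; apply: none; exists j, k.
have [? ? ? ? con] := feas.
have : gamma + 1 <= gamma.
  apply: (opt F nurho _ nuinv kappa); split=> // x y z idx j.
  have := con _ _ _ idx j; have : at1 (b j) x * x%:R <= 0 by rewrite mulr_le0_ge0.
  lra.
lra.
Qed.

(** At the triple [(k, k, k)] all terms in [F] cancel. *)
Lemma feasible_diag j k : program_feasible b P F nurho gamma nuinv kappa ->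
    (1 <= k <= n)%N ->
  0 <= (nuinv - nurho) * at1 (b j) k /\ 0 <= (1 - gamma) * at1 (b j) k.
Proof.
move=> [_ _ _ con1 con2] kn.
have k0 : 0 < k%:R :> R by rewrite ltr0n; lia.
have idx := index_set_diag _ kn.
have := con1 _ _ _ idx j; have := con2 _ _ _ idx j.
rewrite !subrr !mul0r !mulr0 !addr0 !subr0 => h2 h1.
by split; rewrite -(pmulr_lge0 _ k0); lra.
Qed.

Lemma rho_gamma_le1 : program_solution b P F nurho gamma nuinv kappa ->
  nurho <= nuinv /\ gamma <= 1.
Proof.
move=> sol; have [j [k kn bjk]] := solution_pos_cost sol.
have [h1 h2] := feasible_diag j _ (proj1 sol) kn; nra.
Qed.

Lemma rho_gamma_ge1 j k : program_feasible b P F nurho gamma nuinv kappa ->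
  at1 (b j) k < 0 -> nuinv <= nurho /\ 1 <= gamma.
Proof.
move=> feas bjk; have kn : (1 <= k <= n)%N.
  by apply/negPn/negP => /at1_out bjk0; rewrite bjk0 ltxx in bjk.
have [h1 h2] := feasible_diag j _ feas kn; nra.
Qed.

(** The triples [(k, k - 1, k - 1)] and [(k - 1, k, k - 1)] leave only the values [F j k] and
    [- F j k], both nonnegative. *)
Lemma constraint_nu0 : program_feasible b P F nurho gamma nuinv kappa ->
    nuinv = 0 -> nurho = 0 -> forall j k, at1 (F j) k = 0.
Proof.
move=> [_ _ _ con _] nu0 rho0 j k.
have [kn|kn] := boolP (1 <= k <= n)%N; last exact: at1_out.
have idx1 : index_set n k k.-1 k.-1 by rewrite /index_set leq_min; lia.
have idx2 : index_set n k.-1 k k.-1 by rewrite /index_set leq_min; lia.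
have kE : k.-1.+1 = k by lia.
have := con _ _ _ idx1 j; have := con _ _ _ idx2 j; rewrite nu0 rho0.
have -> : k%:R = k.-1%:R + 1 :> R by rewrite natr1 kE.
rewrite kE; lra.
Qed.

Lemma solution_pos : (0 < n)%N -> 1 <= P -> (MinPoA (nnspan b) <= P%:E)%E ->
    program_solution b P F nurho gamma nuinv kappa ->
  0 < nuinv /\ 0 < gamma.
Proof.
move=> n0 P1 MinPoAle sol.
have P0 : 0 < P by lra.
have [feas opt] := sol; have [rho_ge nu0 k0 con1 con2] := feas.
have [le1 gle1] := rho_gamma_le1 sol.
have [j0 [k0' kn bjk]] := solution_pos_cost sol.
have rho0 : 0 <= nurho by rewrite (le_trans _ rho_ge)// mulr_ge0// invr_ge0 ltW.
have gamma0 : 0 < gamma.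
  have [[j [k bneg]]|none] := pselect (exists j, exists k, at1 (b j) k < 0).
    have [_] := rho_gamma_ge1 _ _ feas bneg; lra.
  have b0 j k : 0 <= at1 (b j) k.
    by rewrite leNgt; apply/negP => bneg; apply: none; exists j, k.
  have [F' F'P] := MinPoA_feasible _ _ _ _ _ n0 b0 P0 MinPoAle.
  have Pi0 : 0 < P^-1 by rewrite invr_gt0.
  (* With [nuinv = 1], [kappa = 0] and [gamma = nurho = P^-1] the two blocks of constraints
     coincide. *)
  apply: lt_le_trans Pi0 _; apply: (opt F' P^-1 _ 1 0).
  split=> //; first by rewrite mulr1.
  - by move=> x y z idx j; rewrite mul1r; exact: F'P.
  - by move=> x y z idx j; rewrite mul0r addr0; exact: F'P.
split=> //; rewrite lt_def nu0 andbT; apply/eqP => nu00.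
have rho00 : nurho = 0 by lra.
have F0 := constraint_nu0 feas nu00 rho00.
(* As [F = 0], the triple [(k0', 0, 0)] leaves only a negative term. *)
have idx : index_set n k0' 0 0 by rewrite /index_set leq_min; lia.
have := con2 _ _ _ idx j0; rewrite !F0 !big1// ?mulr0.
have : 0 < at1 (b j0) k0' * k0'%:R by rewrite mulr_gt0// ltr0n; lia.
by move=> ?; nra.
Qed.

End Program.

(** * Upper bounds on the Prices of Anarchy and Stability *)

Section Bounds.
Context {R : realType} {n m : nat} {b : 'I_m -> {ffun 'I_n -> R}} {P : R}.
Context {F : 'I_m -> {ffun 'I_n -> R}} {nurho gamma nuinv kappa : R}.
Context (T : local_rule R n) (Tlin : linear_rule b T).
Context (TF : forall (j : 'I_m) (x : nat), (1 <= x <= n)%N ->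
  at1 (T (b j)) x = at1 (F j) x - at1 (b j) x).
Context (feas : program_feasible b P F nurho gamma nuinv kappa).

Lemma PoA_le : 0 < nurho <= nuinv ->
  (PoA (taxed_games (nnspan b) T) <= (1 / (nurho / nuinv))%:E)%E.
Proof.
move=> /andP[rho0 rho_le]; have nu0 : 0 < nuinv by lra.
have [_ _ _ con _] := feas.
apply: ge_ereal_sup => _ [G GT <-]; apply: ge_ereal_sup => _ [a nasha <-].
rewrite div1r; apply: efficiency_le; [by rewrite divr_gt0| |by case: nasha|].
  by rewrite ler_pdivrMr// mul1r.
have [a' feas' ->] := min_cost_attained G.
rewrite mulrAC ler_pdivrMr// [leRHS]mulrC.
apply: (taxed_game_smooth _ _ _ b F T _ _ 0 Tlin TF _ G) => //; last by rewrite !mul0r.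
by move=> x y z idx j; rewrite mul0r addr0; exact: con.
Qed.

Lemma PoS_le : 0 < gamma <= 1 ->
  (PoS (taxed_games (nnspan b) T) <= (1 / gamma)%:E)%E.
Proof.
move=> /andP[gamma0 gamma_le]; have [_ _ kappa0 _ con] := feas.
apply: ge_ereal_sup => _ [G GT <-].
have [a feasa mina] := feasible_argmin G (potential G).
have nasha := min_potential_nash G a feasa mina.
apply: ge_ereal_inf; exists (efficiency a); first by exists a.
rewrite div1r; apply: efficiency_le => //.
have [a' feas' ->] := min_cost_attained G; rewrite -[leRHS]mul1r.
apply: (taxed_game_smooth _ _ _ b F T _ _ kappa Tlin TF _ G) => //.
  by move=> x y z idx j; rewrite mul1r; exact: con.
by rewrite ler_wpM2l// mina.
Qed.

End Bounds.

(** * The largest ratio for given [F], and tightness of the Price of Anarchy *)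

(** Dividing by [s] restores the form of the first block; the second involves neither [nurho] nor
    [nuinv]. The triple [(k, 0, 0)] at a positive cost excludes [s = 0]. *)
Lemma program_feasible_scale (R : realType) (n m : nat)
    (b : 'I_m -> {ffun 'I_n -> R}) (P : R) (F : 'I_m -> {ffun 'I_n -> R})
    (nurho gamma nuinv kappa rho s : R) :
    0 < P -> program_feasible b P F nurho gamma nuinv kappa ->
    (exists j, exists2 k, (1 <= k <= n)%N & 0 < at1 (b j) k) ->
    P^-1 <= rho -> 0 <= s ->
    (forall x y z, index_set n x y z -> forall j : 'I_m,
      0 <= at1 (b j) y * y%:R - rho * at1 (b j) x * x%:R
           + s * ((x%:R - z%:R) * at1 (F j) x - (y%:R - z%:R) * at1 (F j) x.+1)) ->
  0 < s /\ program_feasible b P F (rho / s) gamma s^-1 kappa.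
Proof.
move=> P0 [_ _ k0 _ con2] [j [k kn bjk]] rhoP s0 con.
have Pi0 : 0 < P^-1 by rewrite invr_gt0.
have spos : 0 < s.
  rewrite lt_def s0 andbT; apply/eqP => s00.
  have idx : index_set n k 0 0 by rewrite /index_set leq_min; lia.
  have := con _ _ _ idx j; rewrite s00 /= !mul0r.
  have : 0 < rho * at1 (b j) k * k%:R.
    by rewrite !mulr_gt0// ?ltr0n; [lra|lia].
  lra.
split=> //; split=> //.
- by rewrite ler_pM2r// invr_gt0.
- by rewrite invr_ge0.
move=> x y z idx i; rewrite -(pmulr_rge0 _ spos).
rewrite (_ : s * _ = at1 (b i) y * y%:R - rho * at1 (b i) x * x%:R
  + s * ((x%:R - z%:R) * at1 (F i) x - (y%:R - z%:R) * at1 (F i) x.+1)).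
  exact: con.
by field; lra.
Qed.

Lemma feasible_normalized (R : realType) (n m : nat)
    (b : 'I_m -> {ffun 'I_n -> R}) (P : R) (F : 'I_m -> {ffun 'I_n -> R})
    (nurho gamma nuinv kappa : R) :
    0 < nuinv -> program_feasible b P F nurho gamma nuinv kappa ->
  forall x y z, index_set n x y z -> forall j : 'I_m,
    0 <= at1 (b j) y * y%:R - nurho / nuinv * at1 (b j) x * x%:R
         + nuinv^-1 * ((x%:R - z%:R) * at1 (F j) x - (y%:R - z%:R) * at1 (F j) x.+1).
Proof.
move=> nu0 [_ _ _ con _] x y z idx j; rewrite -(pmulr_rge0 _ nu0).
rewrite (_ : nuinv * _ = nuinv * at1 (b j) y * y%:R - nurho * at1 (b j) x * x%:R
             + (x%:R - z%:R) * at1 (F j) x - (y%:R - z%:R) * at1 (F j) x.+1).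
  exact: con.
by field; lra.
Qed.

(** Diagonal triples bound the ratios by 1. Their supremum is attained because, for fixed [F], the
    normalized constraints are a linear system in the one unknown [nuinv^-1]. *)
Lemma rho_maximal_exists (R : realType) (n m : nat)
    (b : 'I_m -> {ffun 'I_n -> R}) (P : R) (F : 'I_m -> {ffun 'I_n -> R})
    (nurho gamma nuinv kappa : R) :
    (0 < n)%N -> 1 <= P -> (MinPoA (nnspan b) <= P%:E)%E ->
    program_solution b P F nurho gamma nuinv kappa ->
  exists nurho' nuinv' : R,
    program_solution b P F nurho' gamma nuinv' kappa /\
    rho_maximal b P F nurho' gamma nuinv' kappa.
Proof.
move=> n0 P1 MinPoAle sol.
have P0 : 0 < P by lra.
have Pi0 : 0 < P^-1 by rewrite invr_gt0.
have [feas opt] := sol; have [nu0 gamma0] := solution_pos n0 P1 MinPoAle sol.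
have [j0 [k0 kn bjk]] := solution_pos_cost sol.
have ratio_le1 r v : 0 < v -> program_feasible b P F r gamma v kappa -> r / v <= 1.
  move=> v0 /feasible_diag-/(_ j0 k0 kn)[h _]; rewrite ler_pdivrMr// mul1r; nra.
have [[j [k bneg]]|none] := pselect (exists j, exists k, at1 (b j) k < 0).
  exists nurho, nuinv; split=> // r v v0 rvfeas.
  apply: le_trans (ratio_le1 _ _ v0 rvfeas) _.
  by rewrite ler_pdivlMr// mul1r; have [] := rho_gamma_ge1 _ _ feas bneg.
have b0 j k : 0 <= at1 (b j) k.
  by rewrite leNgt; apply/negP => bneg; apply: none; exists j, k.
pose ratios : set R := [set q | exists r v, [/\ 0 < v,
  program_feasible b P F r gamma v kappa & q = r / v]]%classic.
have ratios_ub : has_ubound ratios.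
  by exists 1 => _ [r [v [v0 rv ->]]]; exact: ratio_le1.
have ratios_in : ratios (nurho / nuinv) by exists nurho, nuinv.
have has_sup_ratios : has_sup ratios by split=> //; exists (nurho / nuinv).
pose rho := sup ratios.
have rho_ge : P^-1 <= rho.
  apply: (le_trans _ (ub_le_sup ratios_ub ratios_in)).
  by rewrite ler_pdivlMr//; case: feas.
pose I := {t : 'I_m * ('I_n.+1 * 'I_n.+1 * 'I_n.+1) |
  index_set n t.2.1.1 t.2.1.2 t.2.2}.
pose j_ (t : I) := (val t).1; pose x_ (t : I) : nat := (val t).2.1.1.
pose y_ (t : I) : nat := (val t).2.1.2; pose z_ (t : I) : nat := (val t).2.2.
pose h t := ((x_ t)%:R - (z_ t)%:R) * at1 (F (j_ t)) (x_ t)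
  - ((y_ t)%:R - (z_ t)%:R) * at1 (F (j_ t)) (x_ t).+1.
(* The index [None] encodes nonnegativity of the unknown; [rho] lowered by [e] is below some
   feasible ratio. *)
have [e e0|v vP] := polyhedron_limit R 1 (option I)
    (fun o _ => if o is Some t then h t else 1)
    (fun o => if o is Some t then
      at1 (b (j_ t)) (y_ t) * (y_ t)%:R - rho * at1 (b (j_ t)) (x_ t) * (x_ t)%:R else 0)
    (fun o => if o is Some t then at1 (b (j_ t)) (x_ t) * (x_ t)%:R else 0).
  have [_ [r [v [v0 rv ->]]] rv_gt] := sup_adherent e0 has_sup_ratios.
  exists (fun=> v^-1) => -[t|]; rewrite big_ord1; last first.
    by rewrite mul1r mulr0 !addr0 invr_ge0 ltW.
  have := feasible_normalized _ _ _ _ _ _ _ _ _ _ v0 rv _ _ _ (valP t) (j_ t).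
  rewrite -/(x_ t) -/(y_ t) -/(z_ t) -/(h t).
  have : (rho - e) * (at1 (b (j_ t)) (x_ t) * (x_ t)%:R) <=
      r / v * (at1 (b (j_ t)) (x_ t) * (x_ t)%:R).
    by rewrite ler_wpM2r ?mulr_ge0// ltW.
  lra.
pose s := v 0%N.
have s0 : 0 <= s by have := vP None; rewrite big_ord1 mul1r addr0.
have [||s_gt0 rsfeas] := program_feasible_scale _ _ _ _ _ _ _ _ _ _ rho s
  P0 feas _ rho_ge s0 _.
- by exists j0, k0.
- move=> x y z idxt j.
  have /and5P[xn yn zn _ _] := idxt.
  have idxo : index_set n (inord x : 'I_n.+1) (inord y : 'I_n.+1) (inord z : 'I_n.+1).
    by rewrite !inordK.
  have := vP (Some (exist _ (j, (inord x, inord y, inord z)) idxo)).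
  by rewrite big_ord1 /h /j_ /x_ /y_ /z_ /= !inordK// -/s; lra.
exists (rho / s), s^-1; split; first by [].
move=> r u u0 ru; rewrite invrK divfK ?gt_eqF//.
by apply: ub_le_sup => //; exists r, u.
Qed.

Theorem theorem2 (R : realType) (n m : nat) (hn : (1 <= n)%N)
    (b : 'I_m -> {ffun 'I_n -> R}) (Pibar : R)
    (hPibar : (MinPoA (nnspan b) <= Pibar%:E)%E)
    (Fopt : 'I_m -> {ffun 'I_n -> R}) (nurho gammaopt nuinv kappaopt : R)
    (hopt : program_solution b Pibar Fopt nurho gammaopt nuinv kappaopt)
    (Topt : local_rule R n)
    (hTlin : linear_rule b Topt)
    (hTopt : forall (j : 'I_m) (x : nat), (1 <= x <= n)%N ->
       at1 (Topt (b j)) x = (at1 (Fopt j) x - at1 (b j) x)%R) :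
  let rhoopt := (nurho / nuinv)%R in
  let GT := taxed_games (nnspan b) Topt in
  [/\ (rho_maximal b Pibar Fopt nurho gammaopt nuinv kappaopt ->
         PoA GT = (1 / rhoopt)%:E),
      (PoA GT <= (1 / rhoopt)%:E)%E,
      (1 / rhoopt <= Pibar)%R,
      (PoS GT <= (1 / gammaopt)%:E)%E &
      exists nurho' nuinv' : R,
        program_solution b Pibar Fopt nurho' gammaopt nuinv' kappaopt /\
        rho_maximal b Pibar Fopt nurho' gammaopt nuinv' kappaopt].
Proof.
move=> rho GT.
have P1 : 1 <= Pibar.
  rewrite -lee_fin; apply: le_trans hPibar; apply: le_ereal_inf_tmp => _ [T _ <-].
  exact: PoA_ge1.
have P0 : 0 < Pibar by lra.
have [feas opt] := hopt.
have [nu0 gamma0] := solution_pos hn P1 hPibar hopt.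
have [rho_le gamma_le] := rho_gamma_le1 hopt.
have rhoP : Pibar^-1 <= rho by rewrite ler_pdivlMr//; case: feas.
have rho0 : 0 < rho by rewrite (lt_le_trans _ rhoP)// invr_gt0.
have nurho0 : 0 < nurho by rewrite -(divfK (lt0r_neq0 nu0) nurho) mulr_gt0.
have PoAle : (PoA GT <= (1 / rho)%:E)%E.
  by apply: (PoA_le _ hTlin hTopt feas); rewrite nurho0.
split=> //.
(* If costs are nonnegative, a smaller Price of Anarchy [p] would make [Fopt], which is [b] plus its
   tax, feasible at the ratio [p^-1 > rho], against maximality. *)
- move=> rhomax; apply/le_anti; rewrite PoAle /= leNgt; apply/negP => PoAlt.
  have [[j [k bneg]]|none] := pselect (exists j, exists k, at1 (b j) k < 0).
    have [rho_ge _] := rho_gamma_ge1 _ _ feas bneg.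
    have rho1 : rho = 1 by rewrite /rho (_ : nurho = nuinv) ?divff ?gt_eqF//; lra.
    have := PoA_ge1 R n (nnspan b) Topt; rewrite leNgt -/GT.
    by move: PoAlt; rewrite rho1 divr1 => ->.
  have b0 j k : 0 <= at1 (b j) k.
    by rewrite leNgt; apply/negP => bneg; apply: none; exists j, k.
  have PoA1 : (1 <= PoA GT)%E := PoA_ge1 _ _ _ _.
  case PoAE : (PoA GT) PoAlt PoA1 => [p| |] // p_lt p1.
  rewrite lte_fin in p_lt; rewrite lee_fin in p1.
  have p0 : 0 < p by lra.
  have pi0 : 0 < p^-1 by rewrite invr_gt0.
  have rho_lt : rho < p^-1 by rewrite -[rho]invrK ltf_pV2 ?posrE ?invr_gt0// -div1r.
  have PoAp : (PoA GT <= (p^-1^-1)%:E)%E by rewrite PoAE invrK.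
  have [s s0 sP] := PoA_le_feasible _ _ _ _ _ _ hn b0 pi0 PoAp.
  have fE j k : at1 (b j) k + at1 (Topt (b j)) k = at1 (Fopt j) k.
    have [kn|kn] := boolP (1 <= k <= n)%N; first by rewrite hTopt// addrC subrK.
    by rewrite !at1_out// addr0.
  have [||s_gt0 rsfeas] := program_feasible_scale _ _ _ _ _ _ _ _ _ _ p^-1 s P0 feas
    (solution_pos_cost hopt) _ s0.
  + by rewrite (le_trans rhoP)// ltW.
  + by move=> x y z idx j; have := sP _ _ _ idx j; rewrite !fE.
  have := rhomax _ _ _ rsfeas; rewrite invr_gt0 => /(_ s_gt0).
  by rewrite invrK divfK ?gt_eqF// leNgt rho_lt.
- by rewrite div1r -[Pibar]invrK lef_pV2// posrE invr_gt0.
- by apply: (PoS_le _ hTlin hTopt feas); rewrite gamma0.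
- exact: rho_maximal_exists hn P1 hPibar hopt.
Qed.
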